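(* Let $S$ be a convex differentiable spiral with sub-exponential and monotonic winding, and assume that $\overline{\dim}_\mathrm{B}S > 1$. Let $f$ be a homeomorphism mapping $S$ onto a line segment which is bi-H\''older with parameters $\beta\geq 1\geq\alpha>0$. Then \[ \beta \ \geq \ \alpha \, + \, \overline{\dim}_\mathrm{B}S \, \left(1-\frac{\alpha}{2}\right) \ \geq \ \max\left\{1+\frac{\alpha}{2}, \ \overline{\dim}_\mathrm{B}S\right\} \ > \ 1 \] and, if $\alpha = 1$, then \[ \beta \ \geq \ 1+ \frac{\overline{\dim}_\mathrm{B}S}{2}. \]
   Context: A spiral is a set $S=\{\phi(t)\exp(it):t\in[0,\infty)\}\cup\{0\}\subset\mathbb{C}$, where $\phi:[0,\infty)\to\mathbb{R}$ is a continuous decreasing function with $\lim_{t\to\infty}\phi(t)=0$ and $\phi(0)=1$. The spiral is convex differentiable if $\phi$ is differentiable and its derivative is non-decreasing. The spiral has monotonic winding if $x\mapsto\phi(x)-\phi(x+2\pi)$ is decreasing in $x\geq0$. The winding is sub-exponential if $\frac{\log\phi(x)}{x}\to0$ as $x\to\infty$. The map $f$ on $S$ is bi-H\''older with parameters $\beta\geq1\geq\alpha>0$ if there are constants $c,C>0$ such that $c|x-y|^{\beta}\leq|f(x)-f(y)|\leq C|x-y|^{\alpha}$ for all $x,y\in S$. The upper box dimension of a totally bounded set $F$ is $\overline{\dim}_{\mathrm B}F=\limsup_{R\to0}\frac{\log N(F,R)}{-\log R}$, where $N(F,R)$ is the minimal number of balls of radius $R$ required to cover $F$. *)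

(* Defs.v *)
From HB Require Import structures.
From mathcomp Require Import all_boot all_order all_algebra complex.
From mathcomp Require Import all_classical all_reals all_analysis.

Set Implicit Arguments.
Unset Strict Implicit.
Unset Printing Implicit Defensive.

Import Order.TTheory GRing.Theory Num.Theory.
Import numFieldNormedType.Exports.

Local Open Scope classical_set_scope.
Local Open Scope ring_scope.
Local Open Scope complex_scope.

(* The topology of the complex plane is carried by the alias [R[i]^o]. Its norm
   takes values in [R[i]]; [cdist] is the real-valued distance. *)
Definition cdist (R : realType) (x y : R[i]^o) : R :=
  ComplexField.Normc.normc (x - y).

(* [phi] stands for a function on [0, +oo[; its values at negative arguments
   play no role below. "Decreasing" is read in the weak sense; a convex
   positive function tending to 0 is strictly decreasing as soon as it is
   weakly so. *)
Definition spiral_function (R : realType) (phi : R -> R) : Prop :=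
  [/\ {within `[0, +oo[, continuous phi},
      {in `[0, +oo[ &, {homo phi : x y / x <= y >-> y <= x}},
      phi x @[x --> +oo] --> (0 : R) &
      phi 0 = 1].

Definition spiral (R : realType) (phi : R -> R) : set R[i]^o :=
  [set (phi t)%:C * (cos t +i* sin t) | t in `[0, +oo[] `|` [set 0].

(* The filter makes the derivative at 0 one-sided. *)
Definition convex_differentiable (R : realType) (phi : R -> R) : Prop :=
  exists dphi : R -> R,
    (forall x : R, 0 <= x ->
       (phi y - phi x) / (y - x) @[y --> within `[0, +oo[ x^'] --> dphi x) /\
    {in `[0, +oo[ &, {homo dphi : x y / x <= y}}.

(* Weak monotonicity again, so that strict monotonicity is a special case. *)
Definition monotonic_winding (R : realType) (phi : R -> R) : Prop :=
  {in `[0, +oo[ &, {homo (fun x => phi x - phi (x + 2 * pi)) :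
                      x y / x <= y >-> y <= x}}.

(* [ln] is 0 outside the positive reals, so the positivity that [log (phi x)]
   presupposes is made explicit. *)
Definition subexponential_winding (R : realType) (phi : R -> R) : Prop :=
  (forall x : R, 0 <= x -> 0 < phi x) /\
  ln (phi x) / x @[x --> +oo] --> (0 : R).

(* Open balls of radius [r] with arbitrary centres. The infimum is a minimum
   when [F] is totally bounded and [0 < r]. *)
Definition covering_number (R : realType) (F : set R[i]^o) (r : R) : R :=
  inf [set (size s)%:R | s in
        [set s : seq R[i]^o | F `<=` \bigcup_(z in [set` s]) ball z r%:C]].

Definition upper_box_dim (R : realType) (F : set R[i]^o) : \bar R :=
  limf_esup (fun r : R => (ln (covering_number F r) / - ln r)%:E) 0^'+.

Definition bi_holder_on (R : realType) (S : set R[i]^o) (f : R[i]^o -> R[i]^o)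
    (beta alpha : R) : Prop :=
  exists c C : R, [/\ 0 < c, 0 < C & forall x y, S x -> S y ->
    c * cdist x y `^ beta <= cdist (f x) (f y) <= C * cdist x y `^ alpha].

Definition homeomorphism_on (R : realType) (S T : set R[i]^o)
    (f : R[i]^o -> R[i]^o) : Prop :=
  [/\ set_bij S T f, {within S, continuous f} &
      exists g : R[i]^o -> R[i]^o,
        {within T, continuous g} /\ {in S, cancel f g}].

Definition line_segment (R : realType) (a b : R[i]^o) : set R[i]^o :=
  [set line_path a b t%:C | t in `[0, 1]].

(* Main.v *)
Require Import Defs.
From mathcomp Require Import all_boot all_order all_algebra complex.
From mathcomp Require Import all_classical all_reals all_analysis.
From mathcomp Require Import ring lra.

(** Write d for the upper box dimension of the spiral S. The lower bound on
    beta comes from counting separated points near the centre of S, before and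
    after applying f.

    Let 1 < s < d and q = 2 / (2 - s). The key fact [spiral_tight_gaps] is that
    there are turns arbitrarily close to the centre at which the gap
    phi u - phi (u + 2 pi) is smaller than phi u ^ q. If instead the gaps were
    eventually at least phi ^ q, then phi would solve a discrete version of the
    differential inequality phi' <= - phi ^ q, hence decay at least as fast as
    t ^ (- p) with p = 1 / (q - 1) = (2 - s) / s ([power_decay]). Such a spiral
    has upper box dimension at most 2 / (1 + p) = s
    ([upper_box_dim_spiral_le]): at scale r one covers the turns up to
    T = r ^ (- 1 / (1 + p)) by their length and the rest by a grid on a square
    of side 2 phi T, and both parts cost about r ^ (- s) balls. The same
    estimate with p = 0 gives d <= 2.

    At a tight turn u, put rho = phi u and r = rho ^ q. Monotonic winding makes
    all later gaps at most r as well, so S is r-dense in the triangle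
    x, y >= 0, x + y <= rho ([spiral_dense]), and the disc of radius rho
    contains at least a constant times (rho / r) ^ 2 points of S at mutual
    distance at least r ([spiral_separated]). Their images lie on a segment, within a constant
    times rho ^ alpha of f 0 and at mutual distance at least a constant times
    r ^ beta. A segment of length L contains at most L / delta + 1 points that
    are delta-separated ([segment_packing]), so
      (rho / r) ^ 2 <= K (rho ^ alpha / r ^ beta + 1),
    that is rho ^ (- 2 (q - 1)) <= K (rho ^ (alpha - beta q) + 1), for
    arbitrarily small rho. Comparing exponents ([powR_exponent_le]) gives
    beta q >= alpha + 2 (q - 1), which is beta >= alpha + s (1 - alpha / 2).
    Letting s tend to d proves the first inequality; the others are elementary
    consequences of 1 < d <= 2. *)

Set Implicit Arguments.
Unset Strict Implicit.
Unset Printing Implicit Defensive.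

Import Order.TTheory GRing.Theory Num.Theory.
Import numFieldNormedType.Exports.

Local Open Scope classical_set_scope.
Local Open Scope ring_scope.
Local Open Scope complex_scope.

(** * Distances, covering numbers and box dimension *)

Lemma cdistE (R : realType) (a b c d : R) :
  cdist (a +i* b) (c +i* d) = Num.sqrt ((a - c) ^+ 2 + (b - d) ^+ 2).
Proof. by []. Qed.

Lemma cdist_ge0 (R : realType) (x y : R[i]^o) : 0 <= cdist x y.
Proof. by rewrite /cdist; case: (x - y) => a b; exact: sqrtr_ge0. Qed.

Lemma cdistC (R : realType) (x y : R[i]^o) : cdist x y = cdist y x.
Proof. by rewrite /cdist -normcN opprB. Qed.

Lemma cdist_triangle (R : realType) (y x z : R[i]^o) :
  cdist x z <= cdist x y + cdist y z.
Proof.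
rewrite /cdist (_ : x - z = (x - y) + (y - z)) ?le_normcD//.
by rewrite addrA subrK.
Qed.

Lemma cdist_le_coord (R : realType) (a b c d : R) :
  cdist (a +i* b) (c +i* d) <= `|a - c| + `|b - d|.
Proof.
rewrite cdistE -[leRHS]ger0_norm ?addr_ge0// -[leRHS]sqrtr_sqr.
rewrite ler_sqrt ?sqr_ge0// [leRHS]sqrrD !real_normK ?num_real//.
by rewrite addrAC lerDl mulrn_wge0// mulr_ge0.
Qed.

Lemma coord_le_cdist (R : realType) (a b c d : R) :
  Num.max `|a - c| `|b - d| <= cdist (a +i* b) (c +i* d).
Proof.
rewrite cdistE ge_max -!sqrtr_sqr !ler_sqrt ?addr_ge0 ?sqr_ge0//.
by rewrite lerDl lerDr !sqr_ge0.
Qed.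

Lemma ball_cdist (R : realType) (z x : R[i]^o) (r : R) :
  ball z r%:C x = (cdist z x < r) :> Prop.
Proof.
rewrite -ball_normE /ball_/= /cdist normc_def -ltcR.
by case: (z - x).
Qed.

(** The centres of the balls are arbitrary members of the nonempty pieces, so a
    cover by pieces of diameter less than [r] costs no change of scale. *)
Lemma covering_number_le (R : realType) (S : set R[i]^o) (r : R) (I : finType)
    (A : I -> set R[i]^o) :
    S `<=` \bigcup_i A i ->
    (forall i x y, A i x -> A i y -> cdist x y < r) ->
  covering_number S r <= #|I|%:R.
Proof.
move=> SA Ar; apply: ge_inf; first by exists 0 => _ [s _ <-].
exists [seq xget 0 (A i) | i : I]; last by rewrite size_map -cardE.
move=> x /SA[i _ Aix]; exists (xget 0 (A i)).
  by apply/mapP; exists i => //; rewrite mem_enum.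
by rewrite ball_cdist; apply: (Ar i) => //; exact: xgetI Aix.
Qed.

(** The nonnegativity of [s] covers the degenerate case of a covering number
    equal to 0, where [ln] takes its default value 0. *)
Lemma upper_box_dim_le (R : realType) (S : set R[i]^o) (s K : R) :
    0 <= s ->
    (forall r, 0 < r < 1 -> covering_number S r <= K * r `^ (- s)) ->
  (upper_box_dim S <= s%:E)%E.
Proof.
move=> s0 NK; apply/lee_addgt0Pr => e e0.
have K0 : 0 < Num.max K 1 by rewrite lt_max ltr01 orbT.
have lnK0 : 0 <= ln (Num.max K 1) by rewrite ln_ge0// le_max lexx orbT.
rewrite /upper_box_dim limf_esupE; apply: ge_ereal_inf.
(* On V the constant is negligible: ln (max K 1) <= e * - ln r. Taking the
   maximum with 1 makes this logarithm nonnegative. *)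
pose V := [set r : R | 0 < r < 1 /\ r <= expR (- (ln (Num.max K 1) / e))].
exists (ereal_sup [set (ln (covering_number S r) / - ln r)%:E | r in V]).
  exists V => //=; near=> r; split.
    by apply/andP; split; near: r; [exact: nbhs_right_gt|exact: nbhs_right_lt].
  by near: r; apply: nbhs_right_le; exact: expR_gt0.
apply: ge_ereal_sup => _ [r [/andP[r0 r1] rle] <-].
rewrite -EFinD lee_fin.
have lnr : 0 < - ln r by rewrite oppr_gt0 ln_lt0// r0.
have lnre : ln (Num.max K 1) <= e * - ln r.
  rewrite -ler_pdivrMl// lerNr mulrC -ler_expR lnK//.
rewrite ler_pdivrMr// mulrDl.
have [N0|N0] := leP (covering_number S r) 0.
  by rewrite ln0// addr_ge0// mulr_ge0// ltW.
apply: (@le_trans _ _ (s * - ln r + ln (Num.max K 1))); last by rewrite lerD2l.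
rewrite mulrN -mulNr -ln_powR.
have rs0 : 0 < r `^ (- s) by rewrite powR_gt0.
rewrite -lnM ?posrE// ler_ln ?posrE ?mulr_gt0//.
rewrite (le_trans (NK r _)) ?r0// mulrC ler_pM2l//.
by rewrite le_max lexx.
Unshelve. all: by end_near. Qed.

(** * Power decay forced by large gaps *)

(** This is the discrete form of the observation that y ^ (- a) grows at least
    at unit rate along a solution of y' <= - y ^ (a + 1). With v = x ^ a the
    hypothesis reads y <= x (1 - v); as a >= 1 and 0 < 1 - v <= 1 it gives
    y ^ a <= v (1 - v), and (1 - v) (1 + v) <= 1 does the rest. *)
Lemma power_gap_step (R : realType) (x y a : R) :
    1 <= a -> 0 < x -> 0 < y -> y <= x - x `^ (a + 1) ->
  (x `^ a)^-1 + 1 <= (y `^ a)^-1.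
Proof.
move=> a1 x0 y0; have a0 : 0 <= a by rewrite (le_trans ler01).
rewrite powRD ?(gt_eqF x0) ?implybT// powRr1 ?(ltW x0)//.
set v := x `^ a => yx.
have v0 : 0 < v by rewrite powR_gt0.
have {}yx : y <= x * (1 - v) by lra.
have v1 : 0 < 1 - v by rewrite -(pmulr_rgt0 _ x0) (lt_le_trans y0).
have yv : y `^ a <= v * (1 - v).
  rewrite (le_trans (ge0_ler_powR a0 _ _ yx)) ?nnegrE ?mulr_ge0 ?(ltW x0) ?(ltW v1) ?(ltW y0)//.
  rewrite powRM ?(ltW x0) ?(ltW v1)// -/v ler_pM2l//.
  by rewrite ge1r_powR// v1/= gerBl (ltW v0).
have vv0 : 0 < v * (1 - v) by rewrite mulr_gt0.
apply: (@le_trans _ _ (v * (1 - v))^-1); last first.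
  by rewrite lef_pV2 ?posrE ?powR_gt0.
rewrite -[leRHS]mul1r ler_pdivlMr//.
rewrite (_ : _ * _ = 1 - v ^+ 2); last by field; exact: lt0r_neq0.
by rewrite gerBl sqr_ge0.
Qed.

(** By [power_gap_step], phi ^ (- a) gains at least 1 at each turn after [u0],
    so after k turns it is at least k + 1, while t has grown at most linearly
    in k. *)
Lemma power_decay (R : realType) (phi : R -> R) (a u0 : R) :
    1 <= a -> 0 <= u0 -> phi 0 = 1 ->
    (forall t : R, 0 <= t -> 0 < phi t) ->
    {in `[0, +oo[ &, {homo phi : x y / x <= y >-> y <= x}} ->
    (forall u, u0 <= u -> phi u `^ (a + 1) <= phi u - phi (u + 2 * pi)) ->
  forall t, 0 <= t -> t * phi t `^ a <= u0 + 2 * pi.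
Proof.
move=> a1 u00 phi0 phi_gt0 phi_dec gap t t0.
have a0 : 0 <= a by rewrite (le_trans ler01).
have pi0 := pi_gt0 R.
have phi1 s : 0 <= s -> phi s <= 1.
  by move=> s0; rewrite -phi0 phi_dec ?in_itv/= ?andbT.
have phia1 s : 0 <= s -> phi s `^ a <= 1.
  move=> s0; apply: (@le_trans _ _ (1 `^ a)); last by rewrite powR1.
  by rewrite ge0_ler_powR ?nnegrE ?ler01 ?phi1 ?(ltW (phi_gt0 _ _)).
have step k : k.+1%:R <= (phi (u0 + 2 * pi * k%:R) `^ a)^-1.
  elim: k => [|k IH].
    by rewrite mulr0 addr0 invf_ge1 ?phia1// powR_gt0// phi_gt0.
  have uk0 : 0 <= 2 * pi * k%:R :> R by rewrite !mulr_ge0// ltW.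
  rewrite -[k.+2]addn1 natrD (le_trans (lerD IH (lexx _)))//.
  apply: power_gap_step => //.
  - by rewrite phi_gt0// addr_ge0.
  - by rewrite phi_gt0// addr_ge0// !mulr_ge0// ltW.
  - have := gap (u0 + 2 * pi * k%:R).
    rewrite lerDl => /(_ uk0).
    have -> : u0 + 2 * pi * k.+1%:R = u0 + 2 * pi * k%:R + 2 * pi.
      by rewrite -natr1; ring.
    by move=> H; lra.
have [tu|ut] := leP t u0.
  rewrite (@le_trans _ _ (t * 1)) ?ler_wpM2l ?phia1// mulr1.
  by rewrite (le_trans tu)// lerDl mulr_ge0// (ltW pi0).
pose x := (t - u0) / (2 * pi).
have x0 : 0 <= x by rewrite divr_ge0 ?mulr_ge0 ?subr_ge0 ?(ltW ut) ?(ltW pi0).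
have /andP[kx xk] := truncn_itv x0; set k := Num.truncn x in kx xk.
have {}kx : u0 + 2 * pi * k%:R <= t.
  by rewrite -lerBrDl mulrC -ler_pdivlMr ?mulr_gt0.
have {}xk : t <= u0 + 2 * pi * k.+1%:R.
  by rewrite -lerBlDl mulrC -ler_pdivrMr ?mulr_gt0// (ltW xk).
have uk0 : 0 <= u0 + 2 * pi * k%:R :> R by rewrite addr_ge0// !mulr_ge0// ltW.
have : phi t `^ a <= k.+1%:R^-1.
  rewrite (@le_trans _ _ (phi (u0 + 2 * pi * k%:R) `^ a))//.
    by rewrite ge0_ler_powR ?nnegrE ?(ltW (phi_gt0 _ _))// phi_dec ?in_itv/= ?andbT.
  by rewrite -[leLHS]invrK lef_pV2 ?posrE ?invr_gt0 ?powR_gt0 ?phi_gt0.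
move=> pk; rewrite (le_trans (ler_wpM2l t0 pk))// ler_pdivrMr//.
rewrite (le_trans xk)// [leRHS]mulrDl lerD2r// ler_peMr//.
by rewrite ler1n.
Qed.

(** * Elementary inequalities *)

(** Concavity of the power function: its graph lies below the tangent at [y].
    The exponent conjugate to 1 / a is infinite when a = 1, hence the separate
    treatment of that case; for a < 1 it is Young's inequality for (x / y) ^ a
    and 1. *)
Lemma powR_tangent (R : realType) (a x y : R) :
    0 < a <= 1 -> 0 <= x -> 0 < y ->
  a * y `^ (a - 1) * (y - x) <= y `^ a - x `^ a.
Proof.
move=> /andP[a0 a1] x0 y0.
have yN0 : y != 0 by rewrite gt_eqF.
have [->|aN1] := eqVneq a 1.
  by rewrite subrr powRr0 !powRr1 ?(ltW y0)// !mul1r.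
have {aN1}a1 : a < 1 by rewrite lt_neqAle aN1.
have H : (x / y) `^ a <= x / y * a + (1 - a).
  have xy0 : 0 <= x / y by rewrite divr_ge0// ltW.
  have := @conjugate_powR R ((x / y) `^ a) 1 a^-1 (1 - a)^-1.
  rewrite powR_ge0 ler01 !invr_gt0 subr_gt0 a0 a1 !invrK -powRrM.
  rewrite mulfV ?gt_eqF// powRr1// powR1 !mulr1 mul1r; apply => //.
  by rewrite subrKC.
rewrite powRB ?yN0 ?implybT// powRr1 ?(ltW y0)//.
have -> : x `^ a = (x / y) `^ a * y `^ a.
  by rewrite -powRM ?divr_ge0 ?(ltW y0)// mulfVK.
have ya0 : 0 < y `^ a by rewrite powR_gt0.
have -> : a * (y `^ a / y) * (y - x) = (a - x / y * a) * y `^ a by field.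
rewrite -[X in _ <= X - _]mul1r -mulrBl ler_pM2r//.
lra.
Qed.

Lemma truncn_eq_dist (R : realType) (x y : R) :
  0 <= x -> 0 <= y -> Num.truncn x = Num.truncn y -> `|x - y| < 1.
Proof.
move=> /truncn_itv + /truncn_itv => + + e; rewrite e.
rewrite -natr1 => /andP[? ?] /andP[? ?]; rewrite ltr_norml; apply/andP; split; lra.
Qed.

Lemma cos_lipschitz (R : realType) (x y : R) : `|cos x - cos y| <= `|x - y|.
Proof.
wlog xy : x y / y <= x.
  move=> H; have [/H//|/ltW/H] := leP y x.
  by rewrite distrC [leRHS]distrC.
have [c _ ->] := @MVT_segment R cos (fun z => - sin z) y x xy
  (fun z _ => is_derive_cos z) (continuous_subspaceT (@continuous_cos R)).
by rewrite normrM normrN ler_piMl// sin_max.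
Qed.

Lemma sin_lipschitz (R : realType) (x y : R) : `|sin x - sin y| <= `|x - y|.
Proof.
wlog xy : x y / y <= x.
  move=> H; have [/H//|/ltW/H] := leP y x.
  by rewrite distrC [leRHS]distrC.
have [c _ ->] := @MVT_segment R sin cos y x xy
  (fun z _ => is_derive_sin z) (continuous_subspaceT (@continuous_sin R)).
by rewrite normrM ler_piMl// cos_max.
Qed.

(** * Covering a spiral *)

Definition spiral_point (R : realType) (phi : R -> R) (t : R) : R[i]^o :=
  (phi t * cos t) +i* (phi t * sin t).

Lemma spiral_inP (R : realType) (phi : R -> R) (z : R[i]^o) :
  spiral phi z <-> (exists2 t, 0 <= t & z = spiral_point phi t) \/ z = 0.
Proof.
have ptE t : (phi t)%:C * (cos t +i* sin t) = spiral_point phi t.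
  by rewrite /spiral_point; simpc.
split=> [[[t] /=|->]|[[t t0 ->]|->]].
- by rewrite in_itv/= andbT => t0 <-; left; exists t.
- by right.
- by left; exists t; rewrite /= ?in_itv/= ?andbT.
- by right.
Qed.

Lemma cdist_ray (R : realType) (a b t : R) :
  cdist ((a * cos t) +i* (a * sin t)) ((b * cos t) +i* (b * sin t)) = `|a - b|.
Proof.
rewrite cdistE -!mulrBl !exprMn -mulrDr cos2Dsin2 mulr1.
by rewrite sqrtr_sqr.
Qed.

Lemma cdist_circle_le (R : realType) (a t u : R) : 0 <= a ->
  cdist ((a * cos t) +i* (a * sin t)) ((a * cos u) +i* (a * sin u))
    <= 2 * a * `|t - u|.
Proof.
move=> a0; apply: le_trans (cdist_le_coord _ _ _ _) _.
rewrite -!mulrBr !normrM ger0_norm// -mulrDr mulrAC mulrC ler_wpM2r//.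
by have := cos_lipschitz t u; have := sin_lipschitz t u; lra.
Qed.

(** Move first along the ray of angle [t], then along the circle of the smaller
    radius [phi u]. Using the smaller radius is what lets the concavity of
    t ^ (1 - p) bound the angular part. *)
Lemma cdist_spiral_point_le (R : realType) (phi : R -> R) (t u : R) :
    t <= u -> 0 <= phi u <= phi t ->
  cdist (spiral_point phi t) (spiral_point phi u)
    <= phi t - phi u + 2 * phi u * (u - t).
Proof.
move=> tu /andP[u0 ut].
apply: (le_trans (cdist_triangle ((phi u * cos t) +i* (phi u * sin t)) _ _)).
rewrite cdist_ray ger0_norm ?subr_ge0// lerD2l.
by apply: le_trans (cdist_circle_le _ _ u0) _; rewrite ler0_norm ?subr_le0// opprB.
Qed.

(** The turns up to [T] and the square of half-side [phi T] around the centre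
    are cut separately. On the turns, the function
    w t = 1 - phi t + E t ^ (1 - p) increases by at least the distance between
    the corresponding points: its first part absorbs the radial motion and the second the angular motion, because
    2 phi u (u - t) <= E (u ^ (1 - p) - t ^ (1 - p)) when E = 2 D / (1 - p).
    Cutting the range of [w] into intervals of length [r] yields the linear
    term of the bound; the quadratic term counts the cells of side r / 2 that
    meet the square. *)
Lemma covering_spiral_le (R : realType) (phi : R -> R) (p D r T : R) :
    {in `[0, +oo[ &, {homo phi : x y / x <= y >-> y <= x}} ->
    (forall t, 0 <= t -> 0 <= phi t) -> phi 0 <= 1 ->
    0 <= p < 1 -> 0 <= D -> (forall t, 0 < t -> phi t <= D * t `^ (- p)) ->
    0 < r -> 0 < T ->
  covering_number (spiral phi) r <=
    (1 + 2 * D / (1 - p) * T `^ (1 - p)) / r + 1 + (4 * phi T / r + 1) ^+ 2.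
Proof.
move=> phi_dec phi_ge0 phi01 /andP[p0 p1] D0 phiD r0 T0.
set E := 2 * D / (1 - p).
have p10 : 0 < 1 - p by rewrite subr_gt0.
have E0 : 0 <= E by rewrite divr_ge0 ?mulr_ge0 ?(ltW p10).
have phi1 s : 0 <= s -> phi s <= 1.
  by move=> s0; rewrite (le_trans _ phi01)// phi_dec ?in_itv/= ?andbT.
pose w t := 1 - phi t + E * t `^ (1 - p).
have w0 t : 0 <= t -> 0 <= w t.
  by move=> t0; rewrite addr_ge0 ?subr_ge0 ?phi1// mulr_ge0// powR_ge0.
have wcdist t u : 0 <= t -> t <= u ->
    cdist (spiral_point phi t) (spiral_point phi u) <= w u - w t.
  move=> t0; rewrite le_eqVlt => /predU1P[<-|tu].
    by rewrite /cdist !subrr ComplexField.Normc.normc0.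
  have u0 : 0 < u by rewrite (le_lt_trans t0).
  have phiut : phi u <= phi t.
    by rewrite phi_dec ?in_itv/= ?andbT// ?(ltW u0)// ltW.
  apply: (le_trans (cdist_spiral_point_le (ltW tu) _)).
    by rewrite phi_ge0// ltW.
  rewrite (_ : w u - w t =
    phi t - phi u + E * (u `^ (1 - p) - t `^ (1 - p))); last by rewrite /w; ring.
  rewrite lerD2l.
  have p1' : 0 < 1 - p <= 1 by rewrite p10 gerBl.
  have := powR_tangent p1' t0 u0; rewrite addrAC subrr add0r => H.
  apply: le_trans (ler_wpM2l E0 H).
  (* E is chosen so that the factor 1 - p from the tangent bound cancels. *)
  rewrite (_ : E * _ = 2 * (D * u `^ (- p)) * (u - t)); last first.
    by rewrite /E; field; exact: lt0r_neq0.
  by rewrite ler_wpM2r ?subr_ge0 ?(ltW tu)// ler_wpM2l// phiD.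
have wcdist' t u : 0 <= t -> 0 <= u ->
    cdist (spiral_point phi t) (spiral_point phi u) <= `|w u - w t|.
  move=> t0 u0; have [tu|/ltW ut] := leP t u.
    exact: (le_trans (wcdist _ _ t0 tu) (ler_norm _)).
  by rewrite cdistC distrC (le_trans (wcdist _ _ u0 ut))// ler_norm.
set rho := phi T.
have rho0 : 0 <= rho by rewrite phi_ge0// ltW.
set WT := 1 + E * T `^ (1 - p).
have WT0 : 0 <= WT by rewrite addr_ge0// mulr_ge0// powR_ge0.
pose M := Num.truncn (WT / r); pose m := Num.truncn (4 * rho / r).
pose A (i : 'I_M.+1 + 'I_m.+1 * 'I_m.+1) : set R[i]^o := match i with
  | inl k => [set spiral_point phi t | t in
      [set t | 0 <= t <= T /\ Num.truncn (w t / r) = k]]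
  | inr kl => [set x +i* y | x in [set x | `|x| <= rho /\
                 Num.truncn (2 * (x + rho) / r) = kl.1] &
               y in [set y | `|y| <= rho /\
                 Num.truncn (2 * (y + rho) / r) = kl.2]]
  end.
apply: (le_trans (covering_number_le (A := A) _ _)).
- have inM t : 0 <= t -> t <= T -> (Num.truncn (w t / r) < M.+1)%N.
    move=> t0 tT; rewrite ltnS le_truncn// ler_pM2r ?invr_gt0//.
    apply: lerD; first by rewrite gerBl phi_ge0.
    by rewrite ler_wpM2l// ge0_ler_powR ?nnegrE ?(ltW p10) ?(ltW T0).
  have inm x : `|x| <= rho -> (Num.truncn (2 * (x + rho) / r) < m.+1)%N.
    move=> xrho; rewrite ltnS le_truncn// ler_pM2r ?invr_gt0//.
    by have := ler_norm x; lra.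
  have inbox x y : `|x| <= rho -> `|y| <= rho -> (\bigcup_i A i) (x +i* y).
    move=> xrho yrho; exists (inr (Ordinal (inm x xrho), Ordinal (inm y yrho))) => //=.
    by exists x => //; exists y.
  move=> z /spiral_inP[[t t0 ->]|->].
    have [tT|/ltW Tt] := leP t T.
      by exists (inl (Ordinal (inM _ t0 tT))) => //; exists t => //=; rewrite t0 tT.
    have phitT : `|phi t| <= rho.
      by rewrite ger0_norm ?phi_ge0// phi_dec ?in_itv/= ?andbT// ltW.
    apply: inbox; rewrite normrM (le_trans _ phitT)// ler_piMr//.
      exact: cos_max.
    exact: sin_max.
  by apply: inbox; rewrite normr0.
- have close x y : 0 <= x -> 0 <= y -> Num.truncn (x / r) = Num.truncn (y / r) ->
      `|x - y| < r.
    move=> x0 y0 xy; have := @truncn_eq_dist _ (x / r) (y / r).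
    rewrite !divr_ge0 ?(ltW r0)// => /(_ isT isT xy).
    by rewrite -mulrBl normrM [`|_^-1|]gtr0_norm ?invr_gt0// ltr_pdivrMr// mul1r.
  move=> [k|kl] z1 z2 /=.
    move=> [t [/andP[t0 _] tk] <-] [u [/andP[u0 _] uk] <-].
    apply: (le_lt_trans (wcdist' _ _ t0 u0)).
    by apply: close; rewrite ?w0// tk uk.
  have close2 x y : `|x| <= rho -> `|y| <= rho ->
      Num.truncn (2 * (x + rho) / r) = Num.truncn (2 * (y + rho) / r) ->
      2 * `|x - y| < r.
    rewrite !ler_norml => /andP[x0 _] /andP[y0 _] /close.
    rewrite -mulrBr normrM ger0_norm// opprD addrACA subrr addr0; apply; lra.
  move=> [x [xr kx] [y [yr ky] <-]] [x' [xr' kx'] [y' [yr' ky'] <-]].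
  apply: (le_lt_trans (cdist_le_coord _ _ _ _)).
  have := close2 _ _ xr xr'; have := close2 _ _ yr yr'.
  by rewrite kx kx' ky ky' => /(_ erefl) ? /(_ erefl) ?; lra.
- rewrite card_sum card_prod !card_ord.
  rewrite natrD natrM -[M.+1%:R]natr1 -[m.+1%:R]natr1 -expr2.
  apply: lerD.
    by rewrite lerD2r truncn_le divr_ge0// ltW.
  rewrite ler_sqr ?nnegrE ?addr_ge0 ?divr_ge0 ?mulr_ge0 ?(ltW r0)//.
  by rewrite lerD2r truncn_le divr_ge0 ?mulr_ge0// ltW.
Qed.

(** Optimising [covering_spiral_le] in [T]: for T = r ^ (- 1 / (1 + p)) the
    terms T ^ (1 - p) / r and (phi T / r) ^ 2 are both of order
    T ^ 2 = r ^ (- 2 / (1 + p)). *)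
Lemma upper_box_dim_spiral_le (R : realType) (phi : R -> R) (p D : R) :
    {in `[0, +oo[ &, {homo phi : x y / x <= y >-> y <= x}} ->
    (forall t, 0 <= t -> 0 <= phi t) -> phi 0 <= 1 ->
    0 <= p < 1 -> 0 <= D -> (forall t, 0 < t -> phi t <= D * t `^ (- p)) ->
  (upper_box_dim (spiral phi) <= (2 / (1 + p))%:E)%E.
Proof.
move=> phi_dec phi_ge0 phi01 /[dup] p01 /andP[p0 p1] D0 phiD.
have p1_gt0 : 0 < 1 + p by rewrite ltr_pwDl.
set E := 2 * D / (1 - p).
have E0 : 0 <= E by rewrite divr_ge0 ?mulr_ge0 ?subr_ge0// ltW.
apply: (@upper_box_dim_le _ _ _ (2 + E + (4 * D + 1) ^+ 2)).
  by rewrite divr_ge0// ltW.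
move=> r /andP[r0 r1]; set T := r `^ (- (1 + p)^-1).
have T0 : 0 < T by rewrite powR_gt0.
have T1 : 1 <= T.
  rewrite -[leLHS](powRr0 r) ger_powR ?r0 ?(ltW r1)//.
  by rewrite oppr_le0 invr_ge0 ltW.
have T2 : T `^ 2 = T ^+ 2 by rewrite -powR_mulrn// ltW.
have -> : r `^ (- (2 / (1 + p))) = T ^+ 2.
  by rewrite -T2 -powRrM mulNr mulrC.
have rT : r^-1 = T `^ (1 + p).
  rewrite -powRrM mulNr mulVf ?lt0r_neq0// powRN powRr1//.
  exact: ltW.
have T1p : T `^ (1 - p) * r^-1 = T ^+ 2.
  rewrite rT -powRD ?(gt_eqF T0) ?implybT// -T2; congr (_ `^ _); ring.
have rT2 : r^-1 <= T ^+ 2 by rewrite rT -T2 ler_powR// lerD2l ltW.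
have phiTr : phi T / r <= D * T.
  apply: (@le_trans _ _ (D * T `^ (- p) / r)).
    by rewrite ler_pM2r ?invr_gt0// phiD.
  rewrite -mulrA rT -powRD ?(gt_eqF T0) ?implybT// addrCA addNr addr0 powRr1//.
  exact: ltW.
have phiT0 : 0 <= phi T by rewrite phi_ge0// ltW.
have T21 : 1 <= T ^+ 2 by rewrite exprn_ege1.
apply: (le_trans (covering_spiral_le phi_dec phi_ge0 phi01 p01 D0 phiD r0 T0)).
rewrite -/E mulrDl mul1r -mulrA T1p.
have : (4 * phi T / r + 1) ^+ 2 <= (4 * D + 1) ^+ 2 * T ^+ 2.
  rewrite -exprMn ler_sqr ?nnegrE.
  - lra.
  - by rewrite addr_ge0// divr_ge0 ?mulr_ge0// ltW.
  - by rewrite mulr_ge0 ?addr_ge0 ?mulr_ge0// ltW.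
by rewrite !mulrDl; lra.
Qed.

(** * Separated points near the centre *)

(** Restricting to the upper half plane keeps the angle equal to an [acos]. *)
Lemma polar_form (R : realType) (x y : R) : 0 <= y ->
  exists2 t, 0 <= t <= pi &
    x = Num.sqrt (x ^+ 2 + y ^+ 2) * cos t /\
    y = Num.sqrt (x ^+ 2 + y ^+ 2) * sin t.
Proof.
move=> y0; set l := Num.sqrt _.
have l2 : l ^+ 2 = x ^+ 2 + y ^+ 2 by rewrite sqr_sqrtr// addr_ge0 ?sqr_ge0.
have : 0 <= l by rewrite sqrtr_ge0.
rewrite le_eqVlt => /predU1P[l0|l_gt0].
  exists 0; first by rewrite lexx pi_ge0.
  move: l2; rewrite -l0 expr0n/= => /esym/eqP.
  by rewrite paddr_eq0 ?sqr_ge0// !sqrf_eq0 => /andP[/eqP-> /eqP->]; rewrite !mul0r.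
have xl : -1 <= x / l <= 1.
  rewrite -ler_norml normrM normfV (gtr0_norm l_gt0) ler_pdivrMr// mul1r.
  by rewrite -(ler_pXn2r (n := 2)) ?nnegrE ?(ltW l_gt0)// real_normK ?num_real// l2 lerDl sqr_ge0.
exists (acos (x / l)); first by rewrite acos_ge0// acos_lepi.
rewrite acosK ?in_itv//= sin_acos// mulrC divfK ?gt_eqF//; split => //.
rewrite -[X in X * _]ger0_norm ?(ltW l_gt0)// -sqrtr_sqr -sqrtrM ?sqr_ge0//.
rewrite mulrBr mulr1 -exprMn mulrC divfK ?gt_eqF// l2 addrAC subrr add0r.
by rewrite sqrtr_sqr ger0_norm.
Qed.

(** On the ray through x + i y, follow the spiral from time [u] on until its
    radius first drops to at most l = |x + i y| <= phi u. The previous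
    crossing of the ray had radius more than l, or came before [u]; either way
    the radius has dropped by at most [r] below l. *)
Lemma spiral_dense (R : realType) (phi : R -> R) (u r x y : R) :
    {in `[0, +oo[ &, {homo phi : x y / x <= y >-> y <= x}} ->
    (forall t, 0 <= t -> 0 <= phi t) -> phi t @[t --> +oo] --> (0 : R) ->
    0 <= u -> (forall t, u <= t -> phi t - phi (t + 2 * pi) <= r) ->
    0 <= x -> 0 <= y -> x + y <= phi u ->
  exists z, [/\ spiral phi z, cdist z 0 <= phi u & cdist (x +i* y) z <= r].
Proof.
move=> phi_dec phi_ge0 phi_cvg u0 gap x0 y0 xyu.
have pi0 := pi_gt0 R.
have [t /andP[t0 tpi] []] := polar_form x y0.
set l := Num.sqrt _ => xE yE.
have : 0 <= l by rewrite sqrtr_ge0.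
rewrite le_eqVlt => /predU1P[l0|l_gt0].
  exists 0; rewrite xE yE -l0 !mul0r /cdist !subrr ComplexField.Normc.normc0.
  split; [by apply/spiral_inP; right|exact: phi_ge0|].
  apply: le_trans (gap u (lexx _)); rewrite subr_ge0 phi_dec ?in_itv/= ?andbT//.
    by rewrite addr_ge0// mulr_ge0// ltW.
  by rewrite lerDl mulr_ge0// ltW.
have lu : l <= phi u.
  apply: le_trans xyu; have := cdist_le_coord x y 0 0.
  by rewrite cdistE !subr0 !ger0_norm.
pose turn k : R := t + 2 * pi * k%:R.
have turn0 k : 0 <= turn k by rewrite addr_ge0// !mulr_ge0// ltW.
have turnS k : turn k.+1 = turn k + 2 * pi.
  by rewrite /turn -natr1; ring.
pose P k := (u <= turn k) && (phi (turn k) <= l).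
have [k0 Pk0] : exists k, P k.
  have : \forall s \near +oo, phi s < l by exact: (cvgr_lt 0).
  case=> M [_ MP]; pose N := Num.max u (M + 1).
  exists (Num.truncn (N / (2 * pi))).+1.
  have NT : N <= turn (Num.truncn (N / (2 * pi))).+1.
    rewrite -[leLHS]add0r lerD// mulrC -ler_pdivrMr ?mulr_gt0//.
    exact/ltW/truncnS_gt.
  apply/andP; split; first by rewrite (le_trans _ NT)// le_max lexx.
  apply/ltW/MP/(lt_le_trans _ NT).
  by rewrite lt_max ltrDl ltr01 orbT.
have {k0 Pk0} exP : exists k, P k by exists k0.
have [k /andP[uk phik] kmin] := ex_minnP exP.
exists (spiral_point phi (turn k)); split.
- by apply/spiral_inP; left; exists (turn k).
- have := cdist_ray (phi (turn k)) 0 (turn k).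
  rewrite !mul0r subr0 ger0_norm ?phi_ge0// => ->.
  by rewrite phi_dec ?in_itv/= ?andbT.
have [cosk sink] : cos (turn k) = cos t /\ sin (turn k) = sin t.
  rewrite /turn (_ : 2 * pi * k%:R = (pi *+ 2) *+ k); last first.
    by rewrite -[RHS]mulr_natr -[pi *+ 2]mulr_natl.
  by rewrite (periodicn (@cosD2pi R)) (periodicn (@sinD2pi R)).
rewrite /spiral_point {1}xE {1}yE cosk sink cdist_ray ger0_norm ?subr_ge0//.
(* The first crossing after time u occurs within one turn, when the radius is
   still at least phi u - r. *)
have early : turn k <= u + 2 * pi -> l - phi (turn k) <= r.
  move=> ku; apply: le_trans (gap u (lexx _)); apply: lerB => //.
  by rewrite phi_dec ?in_itv/= ?andbT// addr_ge0// mulr_ge0// ltW.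
case: k => [|k] in uk phik kmin cosk sink early *.
  apply: early; rewrite /turn mulr0 addr0 (le_trans tpi)//.
  by rewrite ler_wpDl// ler_peMl ?ler1n// ltW.
have : ~~ P k by apply/negP => /kmin; rewrite ltnn.
rewrite negb_and -!ltNge => /orP[ku|lk].
  by apply: early; rewrite turnS lerD2r ltW.
have [ku|ku] := ltP (turn k) u; first by apply: early; rewrite turnS lerD2r ltW.
apply: le_trans (gap _ ku); rewrite -turnS; apply: lerB => //; exact: ltW.
Qed.

(** Take a grid of mesh [3 * r] in the positive quadrant and replace each node
    by a point of the spiral within [r]; two of the three [r]'s pay for the
    displacements. The factor 6 keeps the sum of both coordinates of each node
    below [phi u]. *)
Lemma spiral_separated (R : realType) (phi : R -> R) (u r : R) (n : nat) :
    {in `[0, +oo[ &, {homo phi : x y / x <= y >-> y <= x}} ->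
    (forall t, 0 <= t -> 0 <= phi t) -> phi t @[t --> +oo] --> (0 : R) ->
    0 <= u -> (forall t, u <= t -> phi t - phi (t + 2 * pi) <= r) ->
    0 < r -> 6 * r * n%:R <= phi u ->
  exists F : 'I_n.+1 * 'I_n.+1 -> R[i]^o,
    (forall i, spiral phi (F i) /\ cdist (F i) 0 <= phi u) /\
    (forall i j, i != j -> r <= cdist (F i) (F j)).
Proof.
move=> phi_dec phi_ge0 phi_cvg u0 gap r0 nu.
pose g (i : 'I_n.+1) : R := 3 * r * i%:R.
have g0 i : 0 <= g i by rewrite !mulr_ge0// ltW.
have gn i : 2 * g i <= phi u.
  apply: le_trans nu; rewrite /g !mulrA -natrM ler_pM2l ?mulr_gt0//.
  by rewrite ler_nat -ltnS.
have /choice[F HF] : forall i : 'I_n.+1 * 'I_n.+1, exists z : R[i]^o,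
    [/\ spiral phi z, cdist z 0 <= phi u & cdist (g i.1 +i* g i.2) z <= r].
  move=> i.
  by apply: spiral_dense => //; have := gn i.1; have := gn i.2; lra.
exists F; split=> [i|i j ij]; first by have [] := HF i.
have gsep (a b : 'I_n.+1) : a != b -> 3 * r <= `|g a - g b|.
  wlog ab : a b / (b < a)%N.
    move=> H ab; have : (a : nat) != b by [].
    rewrite neq_ltn => /orP[ab'|/H]; last exact.
    by rewrite distrC; apply: H => //; rewrite eq_sym.
  move=> _; rewrite -mulrBr normrM ger0_norm ?mulr_ge0 ?(ltW r0)//.
  rewrite ler_peMr ?mulr_ge0 ?(ltW r0)//.
  rewrite -natrB ?(ltnW ab)// normr_nat ler1n subn_gt0//.
have grid : 3 * r <= cdist (g i.1 +i* g i.2) (g j.1 +i* g j.2).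
  apply: le_trans (coord_le_cdist _ _ _ _); rewrite le_max.
  move: ij; rewrite -pair_eqE negb_and => /orP[/gsep->//|/gsep->].
  by rewrite orbT.
have [_ _ Hi] := HF i; have [_ _ Hj] := HF j.
have := cdist_triangle (F i) (g i.1 +i* g i.2) (g j.1 +i* g j.2).
have := cdist_triangle (F j) (F i) (g j.1 +i* g j.2).
rewrite [cdist (F j) (g _ +i* _)]cdistC; lra.
Qed.

(** * Packing a segment *)

(** The parameter on the segment, scaled by its length; this form also covers a
    segment reduced to a point, whose parameter is not determined. *)
Lemma segment_isometry (R : realType) (a b : R[i]^o) :
  exists tau : R[i]^o -> R, forall x y, line_segment a b x ->
    line_segment a b y -> cdist x y = `|tau x - tau y|.
Proof.
have /choice[T HT] : forall x : R[i]^o, exists t : R,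
    line_segment a b x -> x = line_path a b t%:C.
  move=> x; have [[t _ <-]|nx] := pselect (line_segment a b x); first by exists t.
  by exists 0.
exists (fun x => T x * ComplexField.Normc.normc (b - a)) => x y.
move=> /HT xE /HT yE; rewrite -mulrBl {1}xE {1}yE /cdist !line_pathEl.
rewrite opprD addrACA subrr addr0 -mulrBl -rmorphB/= ComplexField.Normc.normcM.
rewrite normrM; congr (_ * _).
  by rewrite /= expr0n addr0 sqrtr_sqr.
by rewrite ger0_norm//; case: (b - a) => ? ?; exact: sqrtr_ge0.
Qed.

(** Pigeonhole: cut an interval of length 2 D around [w] into intervals of
    length [delta]; none of them contains two of the points. *)
Lemma segment_packing (R : realType) (a b w : R[i]^o) (I : finType)
    (F : I -> R[i]^o) (delta D : R) :
    0 < delta -> 0 <= D -> line_segment a b w ->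
    (forall i, line_segment a b (F i) /\ cdist (F i) w <= D) ->
    (forall i j, i != j -> delta <= cdist (F i) (F j)) ->
  #|I|%:R <= 2 * D / delta + 1.
Proof.
move=> delta0 D0 ww HF sep.
have [tau tauE] := segment_isometry a b.
pose h i := (tau (F i) - tau w + D) / delta.
have h_itv i : 0 <= h i <= 2 * D / delta.
  have [Fi] := HF i; rewrite tauE// ler_norml => /andP[? ?].
  rewrite divr_ge0 ?(ltW delta0)//=; last by lra.
  by rewrite ler_pM2r ?invr_gt0//; lra.
have hM i : (Num.truncn (h i) < (Num.truncn (2 * D / delta)).+1)%N.
  by rewrite ltnS le_truncn//; case/andP: (h_itv i).
have : injective (fun i => Ordinal (hM i)).
  move=> i j [] /truncn_eq_dist.
  have [/andP[-> _] /andP[-> _]] := (h_itv i, h_itv j) => /(_ isT isT).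
  rewrite -mulrBl opprD addrACA subrr addr0 opprD addrACA subrr addr0.
  rewrite normrM [`|_^-1|]gtr0_norm ?invr_gt0// ltr_pdivrMr// mul1r.
  have [Fi _] := HF i; have [Fj _] := HF j; rewrite -tauE// => lt.
  by apply/eqP; apply: contraTT lt => /sep; rewrite -leNgt.
move=> /leq_card; rewrite card_ord -(ler_nat R) => /le_trans; apply.
by rewrite -natr1 lerD2r truncn_le divr_ge0 ?mulr_ge0// ltW.
Qed.

(** Transporting the separated points of [spiral_separated] to the segment: the
    lower Hoelder bound keeps them c r ^ beta apart and the upper one keeps
    them within C (phi u) ^ alpha of [f 0]. *)
Lemma holder_packing_estimate (R : realType) (phi : R -> R)
    (f : R[i]^o -> R[i]^o) (a b : R[i]^o) (alpha beta c C u r : R) :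
    {in `[0, +oo[ &, {homo phi : x y / x <= y >-> y <= x}} ->
    (forall t, 0 <= t -> 0 <= phi t) -> phi t @[t --> +oo] --> (0 : R) ->
    (forall x, spiral phi x -> line_segment a b (f x)) ->
    0 < c -> 0 < C -> 0 <= alpha -> 0 <= beta ->
    (forall x y, spiral phi x -> spiral phi y ->
      c * cdist x y `^ beta <= cdist (f x) (f y) <= C * cdist x y `^ alpha) ->
    0 <= u -> (forall t, u <= t -> phi t - phi (t + 2 * pi) <= r) -> 0 < r ->
  (phi u / (6 * r)) ^+ 2 <= 2 * (C * phi u `^ alpha) / (c * r `^ beta) + 1.
Proof.
move=> phi_dec phi_ge0 phi_cvg fS c0 C0 alpha0 beta0 fH u0 gap r0.
have x0 : 0 <= phi u / (6 * r) by rewrite divr_ge0 ?phi_ge0// mulr_ge0// ltW.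
have /andP[nx xn] := truncn_itv x0; set n := Num.truncn _ in nx xn.
have nu : 6 * r * n%:R <= phi u by rewrite mulrC -ler_pdivlMr ?mulr_gt0.
have [F [FS Fsep]] := spiral_separated phi_dec phi_ge0 phi_cvg u0 gap r0 nu.
have S0 : spiral phi 0 by apply/spiral_inP; right.
have := @segment_packing R a b (f 0) _ (fun i => f (F i)) (c * r `^ beta)
  (C * phi u `^ alpha).
rewrite card_prod !card_ord natrM -expr2 => H.
apply: (@le_trans _ _ (n.+1%:R ^+ 2)).
  by rewrite ler_sqr ?nnegrE// ltW.
apply: H.
- by rewrite mulr_gt0// powR_gt0.
- by rewrite mulr_ge0 ?powR_ge0// ltW.
- exact: fS.
- move=> i; have [Fi Fu] := FS i; split; first exact: fS.
  have /andP[_ /le_trans] := fH _ _ Fi S0; apply.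
  by rewrite ler_pM2l// ge0_ler_powR ?nnegrE ?cdist_ge0// phi_ge0.
- move=> i j /Fsep rij; have [Fi _] := FS i; have [Fj _] := FS j.
  have /andP[+ _] := fH _ _ Fi Fj; apply: le_trans.
  by rewrite ler_pM2l// ge0_ler_powR ?nnegrE ?cdist_ge0// ltW.
Qed.

(** If e > - m, multiplying by x ^ m gives 1 <= K (x ^ (e + m) + x ^ m), whose
    right-hand side tends to 0 with x. *)
Lemma powR_exponent_le (R : realType) (e m K : R) :
    0 < m -> 0 <= K ->
    (forall eps, 0 < eps -> exists2 x, 0 < x < eps &
      x `^ (- m) <= K * (x `^ e + 1)) ->
  e <= - m.
Proof.
move=> m0 K0 H; rewrite leNgt; apply/negP => em.
have em0 : 0 < e + m by rewrite -ltrBlDr sub0r.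
pose eta := (2 * (K + 1))^-1.
have eta0 : 0 < eta by rewrite invr_gt0 mulr_gt0// ltr_wpDl.
have small y : 0 < y -> \forall x \near 0^'+, x `^ y < eta.
  by move=> y0; exact: (cvgr_lt 0 (powR_cvg0 y0)).
have [eps /= eps0 Heps] : \forall x \near 0^'+, x `^ (e + m) < eta /\ x `^ m < eta.
  by near=> x; split; near: x; exact: small.
have [x /andP[x0 xeps]] := H _ eps0.
have [|//|] := Heps x; first by rewrite /= sub0r normrN gtr0_norm.
have xm0 : 0 < x `^ m by rewrite powR_gt0.
rewrite powRD ?(gt_eqF x0) ?implybT// => xem xm.
rewrite powRN -div1r ler_pdivrMr// -mulrA mulrDl mul1r.
apply/negP; rewrite -ltNge.
apply: (@le_lt_trans _ _ (K * (eta + eta))).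
  by rewrite ler_wpM2l// lerD// ltW.
have -> : K * (eta + eta) = K / (K + 1) by rewrite /eta; field; lra.
by rewrite ltr_pdivrMr ?mul1r ?ltrDl// ltr_wpDl.
Unshelve. all: by end_near. Qed.

(** * The lower bound on the Hoelder exponent *)

(** Otherwise phi would decay like t ^ (- 1 / a) with a + 1 = 2 / (2 - s), that
    is a = s / (2 - s), and the box dimension would be at most
    2 / (1 + 1 / a) = s. *)
Lemma spiral_tight_gaps (R : realType) (phi : R -> R) (s : R) :
    {in `[0, +oo[ &, {homo phi : x y / x <= y >-> y <= x}} ->
    (forall t, 0 <= t -> 0 < phi t) -> phi t @[t --> +oo] --> (0 : R) ->
    phi 0 = 1 -> 1 < s < 2 -> (s%:E < upper_box_dim (spiral phi))%E ->
  forall eps, 0 < eps -> exists u, [/\ 0 <= u, phi u < eps &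
    phi u - phi (u + 2 * pi) < phi u `^ (2 / (2 - s))].
Proof.
move=> phi_dec phi_gt0 phi_cvg phi0 /andP[s1 s2] sdim eps eps0.
apply: contrapT => nogap.
have [M [_ MP]] : \forall t \near +oo, phi t < eps by exact: (cvgr_lt 0).
pose u0 := Num.max 0 (M + 1).
have u00 : 0 <= u0 by rewrite le_max lexx.
have gap u : u0 <= u ->
    phi u `^ (s / (2 - s) + 1) <= phi u - phi (u + 2 * pi).
  move=> u0u; rewrite leNgt; apply/negP => lt; apply: nogap; exists u; split.
  - exact: le_trans u0u.
  - apply: MP; apply: lt_le_trans u0u.
    by rewrite lt_max ltrDl ltr01 orbT.
  - by rewrite (_ : 2 / _ = s / (2 - s) + 1)//; field; lra.
set a := s / (2 - s) in gap.
have a1 : 1 <= a by rewrite ler_pdivlMr; lra.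
have a0 : 0 < a by rewrite (lt_le_trans ltr01).
have decay := power_decay a1 u00 phi0 phi_gt0 phi_dec gap.
have D0 : 0 <= u0 + 2 * pi by rewrite addr_ge0// mulr_ge0// ltW// pi_gt0.
move: sdim; apply/negP; rewrite -leNgt.
have -> : s = 2 / (1 + (2 - s) / s) by field; lra.
apply: (@upper_box_dim_spiral_le _ _ _ ((u0 + 2 * pi) `^ a^-1)) => //.
- by move=> t /phi_gt0/ltW.
- by rewrite phi0.
- by rewrite divr_ge0 ?ltr_pdivrMr//=; lra.
- by rewrite powR_ge0.
- move=> t t0; have pt := phi_gt0 _ (ltW t0).
  have -> : (2 - s) / s = a^-1 by rewrite invf_div.
  rewrite powRN ler_pdivlMr ?powR_gt0//.
  have -> : phi t = (phi t `^ a) `^ a^-1.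
    by rewrite -powRrM mulfV ?lt0r_neq0// powRr1 ?(ltW pt).
  rewrite -powRM ?powR_ge0 ?(ltW t0)//.
  rewrite ge0_ler_powR ?nnegrE ?invr_ge0 ?(ltW a0) ?mulr_ge0 ?powR_ge0 ?(ltW t0)//.
  by rewrite mulrC decay// ltW.
Qed.

(** The packing estimate is applied at the scale r = phi u ^ q rather than at
    the gap itself, so that both sides are powers of [phi u]; the exponents are
    then compared as [phi u] tends to 0. *)
Lemma holder_exponent_ge (R : realType) (phi : R -> R)
    (f : R[i]^o -> R[i]^o) (a b : R[i]^o) (alpha beta s : R) :
    {in `[0, +oo[ &, {homo phi : x y / x <= y >-> y <= x}} ->
    (forall t, 0 <= t -> 0 < phi t) -> phi t @[t --> +oo] --> (0 : R) ->
    phi 0 = 1 -> monotonic_winding phi ->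
    (forall x, spiral phi x -> line_segment a b (f x)) ->
    0 <= alpha -> 0 <= beta -> bi_holder_on (spiral phi) f beta alpha ->
    1 < s < 2 -> (s%:E < upper_box_dim (spiral phi))%E ->
  alpha + s * (1 - alpha / 2) <= beta.
Proof.
move=> phi_dec phi_gt0 phi_cvg phi0 mono fS alpha0 beta0 [c [C [c0 C0 fH]]] s12 sdim.
have /andP[s1 s2] := s12.
have tight := spiral_tight_gaps phi_dec phi_gt0 phi_cvg phi0 s12 sdim.
set q := 2 / (2 - s) in tight.
have s20 : 0 < 2 - s by lra.
have q1 : 1 < q by rewrite ltr_pdivlMr; lra.
suff H : alpha - beta * q <= - (2 * (q - 1)).
  suff : (alpha + s * (1 - alpha / 2)) * q <= beta * q.
    by rewrite ler_pM2r// (lt_trans ltr01).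
  have -> : (alpha + s * (1 - alpha / 2)) * q = 2 * q - 2 + alpha.
    by rewrite /q; field; lra.
  lra.
clearbody q; apply: (@powR_exponent_le _ _ _ (36 * (2 * C / c + 1))); first by lra.
  by rewrite mulr_ge0// addr_ge0// divr_ge0 ?mulr_ge0// ltW.
move=> eps /tight[u [u0 ueps gap]]; have pu := phi_gt0 _ u0.
exists (phi u); first by rewrite pu.
have phi_ge0 t : 0 <= t -> 0 <= phi t by move=> /phi_gt0/ltW.
set x := phi u in ueps gap pu *.
have gaps t : u <= t -> phi t - phi (t + 2 * pi) <= x `^ q.
  move=> ut; apply: le_trans (ltW gap).
  by apply: mono => //; rewrite in_itv/= andbT// (le_trans u0).
have xq0 : 0 < x `^ q by rewrite powR_gt0.
have := holder_packing_estimate phi_dec phi_ge0 phi_cvg fS c0 C0 alpha0 beta0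
  fH u0 gaps xq0.
rewrite -/x -powRrM.
have -> : (x / (6 * x `^ q)) ^+ 2 = x `^ (- (2 * (q - 1))) / 36.
  have -> : - (2 * (q - 1)) = (1 - q) * 2%:R by ring.
  rewrite powRrM powR_mulrn ?powR_ge0// powRB ?(gt_eqF pu) ?implybT//.
  rewrite powRr1 ?(ltW pu)//; field; exact: lt0r_neq0.
have -> : 2 * (C * x `^ alpha) / (c * x `^ (q * beta)) =
    2 * C / c * x `^ (alpha - beta * q).
  rewrite powRB ?(gt_eqF pu) ?implybT// [beta * q]mulrC; field.
  by rewrite !gt_eqF// powR_gt0.
set X := x `^ (alpha - _) => H.
have X0 : 0 <= X by exact: powR_ge0.
have CcX : 0 <= 2 * C / c by rewrite divr_ge0 ?mulr_ge0// ltW.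
by move: H CcX; set Y := 2 * C / c => H CcX; lra.
Qed.

Theorem corollary7p3 (R : realType) (phi : R -> R) (f : R[i]^o -> R[i]^o)
    (a b : R[i]^o) (alpha beta : R)
    (hspiral : spiral_function phi)
    (hconvex : convex_differentiable phi)
    (hsubexp : subexponential_winding phi)
    (hmono : monotonic_winding phi)
    (hdim : (1 < upper_box_dim (spiral phi))%E)
    (hhomeo : homeomorphism_on (spiral phi) (line_segment a b) f)
    (halpha0 : 0 < alpha) (halpha1 : alpha <= 1) (hbeta : 1 <= beta)
    (hholder : bi_holder_on (spiral phi) f beta alpha) :
  (let d := upper_box_dim (spiral phi) in
   [/\ alpha%:E + d * (1 - alpha / 2)%:E <= beta%:E,
       maxe (1 + alpha / 2)%:E d <= alpha%:E + d * (1 - alpha / 2)%:E,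
       1 < maxe (1 + alpha / 2)%:E d &
       alpha = 1%R -> 1 + d * (2^-1)%:E <= beta%:E])%E.
Proof.
have [_ phi_dec phi_cvg phi0] := hspiral.
have [phi_gt0 _] := hsubexp.
have [[fS _ _] _ _] := hhomeo.
have alpha2 : 0 < 1 - alpha / 2 by lra.
(* The bound phi <= 1 is power decay with exponent p = 0. *)
have d2 : (upper_box_dim (spiral phi) <= 2%:E)%E.
  have -> : 2 = 2 / (1 + 0) :> R by rewrite addr0 divr1.
  apply: (@upper_box_dim_spiral_le _ _ 0 1) => //.
  - by move=> t /phi_gt0/ltW.
  - by rewrite phi0.
  - by rewrite lexx ltr01.
  - move=> t t0; rewrite oppr0 powRr0 mulr1 -phi0 phi_dec ?in_itv/= ?andbT//;
    exact: ltW.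
have main s : 1 < s < 2 -> (s%:E < upper_box_dim (spiral phi))%E ->
    alpha + s * (1 - alpha / 2) <= beta.
  apply: (holder_exponent_ge phi_dec phi_gt0 phi_cvg phi0 hmono _ _ _ hholder).
  - by move=> x Sx; exact: fS.
  - exact: ltW.
  - exact: le_trans hbeta.
move: hdim d2 main.
case: (upper_box_dim (spiral phi)) => [d||]//.
rewrite lte_fin lee_fin => d1 d2 main /=.
have bound : alpha + d * (1 - alpha / 2) <= beta.
  apply/ler_addgt0Pr => e e0.
  (* s lies strictly between 1 and d, and within e of d. *)
  pose s := Num.max ((1 + d) / 2) (d - e).
  have sd : s < d by rewrite gt_max; apply/andP; split; lra.
  have s12 : 1 < s < 2.
    by rewrite (lt_le_trans sd d2) andbT lt_max; apply/orP; left; lra.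
  have ds : d - e <= s by rewrite le_max lexx orbT.
  have := main s s12; rewrite lte_fin => /(_ sd).
  have : (d - s) * (1 - alpha / 2) <= e * 1.
    by apply: ler_pM; lra.
  lra.
rewrite -!EFin_max -!EFinM -!EFinD !lee_fin !lte_fin; split => //.
- rewrite ge_max; apply/andP; split; nra.
- by rewrite lt_max d1 orbT.
- by move=> alpha1; move: bound; rewrite alpha1; lra.
Qed.
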